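(* Let $(L,\cdot)$ be a quasigroup (respectively, loop) with holomorph $H(L)$. Then $H(L)$ is a CIPQ (respectively, CIPL) if and only if $AUM(L)$ is an abelian group and any one of the following holds for all $x,y\in L$ and all $\alpha,\beta\in AUM(L)$ (that is, for each of the four conditions separately, $H(L)$ is a CIPQ (CIPL) if and only if $AUM(L)$ is abelian and that condition holds): 1. $(x\beta\cdot y)\cdot x^\rho=y\alpha$; 2. $x\beta\cdot (y\cdot x^\rho)=y\alpha$; 3. $(x^\lambda\alpha^{-1}\beta\alpha\cdot y\alpha)\cdot x=y$; 4. $x^\lambda\alpha^{-1}\beta\alpha\cdot (y\alpha\cdot x)=y$.
   Context: Mappings are written on the right of their arguments, so $x\alpha$ is the image of $x$ under $\alpha$, and $\alpha\beta$ means first $\alpha$, then $\beta$; thus $x^\lambda\alpha^{-1}\beta\alpha$ is the image of $x^\lambda$ under the map $\alpha^{-1}\beta\alpha$. A quasigroup $(L,\cdot)$ is a non-empty set with a binary operation such that for all $a,b\in L$ the equations $a\cdot x=b$ and $y\cdot a=b$ have unique solutions $x,y\in L$. A loop is a quasigroup with a (unique) two-sided identity element $e$. For $x\in L$, the right inverse $x^\rho=xJ_\rho$ and the left inverse $x^\lambda=xJ_\lambda$ are the elements with $x\cdot x^\rho=e^\rho$ and $x^\lambda\cdot x=e^\lambda$, where $e^\rho$ and $e^\lambda$ are the right and left identity elements; whenever inverses are used in a quasigroup these elements are assumed to exist (in a loop both equal $e$). $AUM(L)$ is the automorphism group: the group of bijections $A$ of $L$ with $xA\cdot yA=(x\cdot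 y)A$ for all $x,y\in L$. The holomorph $H(L)$ is the set of pairs $(\alpha,x)$ with $\alpha\in AUM(L)$, $x\in L$, with operation $(\alpha,x)\circ(\beta,y)=(\alpha\beta,\ x\beta\cdot y)$. A quasigroup (loop) is a CIPQ (CIPL), i.e. a cross inverse property quasigroup (loop), if it satisfies one of the equivalent identities $(xy)x^\rho=y$, $x(yx^\rho)=y$, $x^\lambda(yx)=y$, $(x^\lambda y)x=y$. *)

(* Defs.v *)
From HB Require Import structures.
From mathcomp Require Import all_boot boolp.

Set Implicit Arguments.
Unset Strict Implicit.
Unset Printing Implicit Defensive.

Local Open Scope group_scope.

(* [magmaType] is the library's bare type with a binary operation [*]. *)
Definition quasigroup (L : magmaType) : Prop :=
  [/\ inhabited L,
      forall a b : L, exists! x : L, a * x = b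
    & forall a b : L, exists! y : L, y * a = b].

Definition is_loop (L : magmaType) : Prop :=
  quasigroup L /\ exists e : L, left_id e *%g /\ right_id e *%g.

(* Inverses are relative to one-sided identities: [J_rho] needs only a right
   identity and [J_lambda] only a left one. In a quasigroup these identities
   are unique when they exist, and then so are [J_rho] and [J_lambda]. *)
Definition cross_inverse (L : magmaType) : Prop :=
  (exists (e : L) (J : L -> L),
     [/\ right_id e *%g, right_inverse e J *%g
       & (forall x y : L, (x * y) * J x = y) \/
         (forall x y : L, x * (y * J x) = y)]) \/
  (exists (e : L) (J : L -> L),
     [/\ left_id e *%g, left_inverse e J *%g
       & (forall x y : L, J x * (y * x) = y) \/
         (forall x y : L, (J x * y) * x = y)]).

Definition CIPQ (L : magmaType) : Prop := quasigroup L /\ cross_inverse L.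
Definition CIPL (L : magmaType) : Prop := is_loop L /\ cross_inverse L.

(* The inverse map is stored as data; [AUM_ext] shows that an element of
   [AUM L] is nevertheless determined by its underlying function. *)
Record AUM (L : magmaType) := MkAUM {
  aum_fun :> L -> L;
  aum_inv_fun : L -> L;
  aum_funK : cancel aum_fun aum_inv_fun;
  aum_inv_funK : cancel aum_inv_fun aum_fun;
  aum_morph : {morph aum_fun : x y / x * y}
}.

Lemma AUM_ext (L : magmaType) (a b : AUM L) : a =1 b -> a = b.
Proof.
case: a => f f' fK f'K fM; case: b => g g' gK g'K gM /= /funext fg.
subst g; have ff' : f' = g' by apply/funext => x; rewrite -{1}(g'K x) fK.
by subst g'; congr MkAUM; apply: Prop_irrelevance.
Qed.

Section AUMGroup.
Variable L : magmaType.
Implicit Types a b : AUM L.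

Definition aum_one : AUM L :=
  @MkAUM L id id (fun=> erefl) (fun=> erefl) (fun _ _ => erefl).

Lemma aum_inv_morph a : {morph aum_inv_fun a : x y / x * y}.
Proof.
move=> x y; apply: (can_inj (aum_funK a)).
by rewrite (aum_morph a) !aum_inv_funK.
Qed.

Definition aum_inv a : AUM L :=
  MkAUM (aum_inv_funK a) (aum_funK a) (@aum_inv_morph a).

Lemma aum_mul_morph a b : {morph b \o a : x y / x * y}.
Proof. by move=> x y /=; rewrite !aum_morph. Qed.

(* Maps act on the right: [aum_mul a b] is first [a], then [b]. *)
Definition aum_mul a b : AUM L :=
  MkAUM (can_comp (aum_funK b) (aum_funK a))
        (can_comp (aum_inv_funK a) (aum_inv_funK b)) (@aum_mul_morph a b).

Lemma aum_mulA : associative aum_mul.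
Proof. by move=> a b c; apply: AUM_ext. Qed.

Lemma aum_mul1 : left_id aum_one aum_mul.
Proof. by move=> a; apply: AUM_ext. Qed.

Lemma aum_mulr1 : right_id aum_one aum_mul.
Proof. by move=> a; apply: AUM_ext. Qed.

Lemma aum_mulV : left_inverse aum_one aum_inv aum_mul.
Proof. by move=> a; apply: AUM_ext => x /=; rewrite aum_inv_funK. Qed.

Lemma aum_mulrV : right_inverse aum_one aum_inv aum_mul.
Proof. by move=> a; apply: AUM_ext => x /=; rewrite aum_funK. Qed.

HB.instance Definition _ := gen_eqMixin (AUM L).
HB.instance Definition _ := gen_choiceMixin (AUM L).
HB.instance Definition _ :=
  isGroup.Build (AUM L) aum_mulA aum_mul1 aum_mulr1 aum_mulV aum_mulrV.

End AUMGroup.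

(* A record rather than a product type, which already carries the
   componentwise multiplication in the library. *)
Record holomorph (L : magmaType) := Hol { hol_aut : AUM L; hol_elt : L }.

Definition hol_mul (L : magmaType) (u v : holomorph L) : holomorph L :=
  Hol (hol_aut u * hol_aut v) (hol_aut v (hol_elt u) * hol_elt v).

HB.instance Definition _ (L : magmaType) :=
  hasMul.Build (holomorph L) (@hol_mul L).

(* In the following conditions [J] is [J_rho] for the first two and
   [J_lambda] for the last two; [x alpha] is written [alpha x], while products
   in [AUM L] keep the order of composition from left to right. *)
Definition hol_cond1 (L : magmaType) (J : L -> L) : Prop :=
  forall (x y : L) (alpha beta : AUM L), (beta x * y) * J x = alpha y.

Definition hol_cond2 (L : magmaType) (J : L -> L) : Prop :=
  forall (x y : L) (alpha beta : AUM L), beta x * (y * J x) = alpha y.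

Definition hol_cond3 (L : magmaType) (J : L -> L) : Prop :=
  forall (x y : L) (alpha beta : AUM L),
    ((alpha^-1 * beta * alpha) (J x) * alpha y) * x = y.

Definition hol_cond4 (L : magmaType) (J : L -> L) : Prop :=
  forall (x y : L) (alpha beta : AUM L),
    (alpha^-1 * beta * alpha) (J x) * (alpha y * x) = y.

(* Main.v *)
From HB Require Import structures.
Require Import Defs.
From mathcomp Require Import all_boot.

(** In a quasigroup with a right identity, cancellation forces the right
    identity and the right inverse map to be unique, makes the two right-handed
    cross inverse identities equivalent, and lets the left-handed identities be
    translated into right-handed ones.  Hence the whole disjunction
    [cross_inverse] reduces to one identity, for whichever inverse map is at
    hand ([cross_inverse_rightP]); passing to the opposite quasigroup gives the
    left-handed version ([cross_inverse_leftP]).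

    It remains to write this identity out in the holomorph.  The identity of
    [H(L)] is [(1, e)] and the inverses of [(alpha, x)] are
    [(alpha^-1, x^rho alpha^-1)] and [(alpha^-1, x^lambda alpha^-1)].  The
    first component of each cross inverse identity for [(alpha, x)] and
    [(beta, y)] says that [beta] is conjugated to itself by [alpha], that is,
    that [AUM(L)] is abelian.  The second component is the stated condition,
    on the right-handed side after applying the automorphism [alpha].  The
    quasigroup and loop axioms themselves always pass from [L] to [H(L)]. *)

Set Implicit Arguments.
Unset Strict Implicit.
Unset Printing Implicit Defensive.

Local Open Scope group_scope.

(** * Cross inverse identities in a quasigroup *)

Lemma quasigroup_mulLI (L : magmaType) (qL : quasigroup L) (a : L) :
  injective (fun x => a * x).
Proof.
case: qL => _ qLl _ x y /= eq_axy; have [z [_ zP]] := qLl a (a * y).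
by rewrite -(zP x) // -(zP y).
Qed.

Lemma quasigroup_mulRI (L : magmaType) (qL : quasigroup L) (a : L) :
  injective (fun x => x * a).
Proof.
case: qL => _ _ qLr x y /= eq_xya; have [z [_ zP]] := qLr a (y * a).
by rewrite -(zP x) // -(zP y).
Qed.

(** Each identity says that one of left multiplication by [x] and right
    multiplication by [J x] is a one-sided inverse of the other; both being
    injective, a one-sided inverse is two-sided. *)
Lemma cross_mulr_swap (L : magmaType) (J : L -> L) : quasigroup L ->
  (forall x y : L, (x * y) * J x = y) <-> (forall x y : L, x * (y * J x) = y).
Proof.
move=> qL; split=> JP x y.
  by apply: (quasigroup_mulRI qL (a := J x)); rewrite JP.
by apply: (quasigroup_mulLI qL (a := x)); rewrite JP.
Qed.

Lemma cross_mull_swap (L : magmaType) (J : L -> L) : quasigroup L ->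
  (forall x y : L, J x * (y * x) = y) <-> (forall x y : L, (J x * y) * x = y).
Proof.
move=> qL; split=> JP x y.
  by apply: (quasigroup_mulLI qL (a := J x)); rewrite JP.
by apply: (quasigroup_mulRI qL (a := x)); rewrite JP.
Qed.

(** If [cross_inverse] is witnessed by a left identity, that identity is also
    [e]; then every [x] is the left inverse of [J x], so that the left-handed
    identity at [J x] is the right-handed one at [x]. *)
Lemma cross_inverse_rightP (L : magmaType) (e : L) (J : L -> L) :
    quasigroup L -> right_id e *%g -> right_inverse e J *%g ->
  cross_inverse L <-> (forall x y : L, (x * y) * J x = y).
Proof.
move=> qL e1 eV; split=> [|JP]; last by left; exists e, J; split=> //; left.
case=> [[e' [J' [e'1 e'V J'P]]] | [e' [J' [e'1 e'V J'P]]]].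
  have ee' : e' = e by apply: (quasigroup_mulLI qL (a := e)); rewrite e'1 e1.
  have eqJ x : J' x = J x.
    by apply: (quasigroup_mulLI qL (a := x)); rewrite e'V eV.
  have {}J'P : forall x y, (x * y) * J' x = y.
    by case: J'P => // /(cross_mulr_swap J' qL).
  by move=> x y; rewrite -eqJ.
have ee' : e' = e by rewrite -[LHS]e1 e'1.
have J'K x : J' (J x) = x.
  by apply: (quasigroup_mulRI qL (a := J x)); rewrite e'V eV.
have {}J'P : forall x y, J' x * (y * x) = y.
  by case: J'P => // /(cross_mull_swap J' qL).
by apply/(cross_mulr_swap J qL) => x y; rewrite -{1}(J'K x) J'P.
Qed.

Definition opposite (L : magmaType) : Type := L.

HB.instance Definition _ (L : magmaType) :=
  hasMul.Build (opposite L) (fun x y : L => y * x).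

Lemma quasigroup_opposite (L : magmaType) :
  quasigroup L -> quasigroup (opposite L).
Proof. by case=> inhL qLl qLr; split. Qed.

Lemma cross_inverse_opposite (L : magmaType) :
  cross_inverse (opposite L) <-> cross_inverse L.
Proof.
by split=> -[[e [J eJP]] | [e [J eJP]]];
  [right | left | right | left]; exists e, J.
Qed.

Lemma cross_inverse_leftP (L : magmaType) (e : L) (J : L -> L) :
    quasigroup L -> left_id e *%g -> left_inverse e J *%g ->
  cross_inverse L <-> (forall x y : L, J x * (y * x) = y).
Proof.
move=> qL e1 eV.
apply: iff_trans (iff_sym (cross_inverse_opposite L)) _.
exact: (@cross_inverse_rightP (opposite L) e J (quasigroup_opposite qL)).
Qed.

(** * The holomorph *)

Lemma quasigroup_holomorph (L : magmaType) :
  quasigroup L -> quasigroup (holomorph L).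
Proof.
move=> qL; have [[x0] qLl qLr] := qL; split; first by exists; exact: Hol 1 x0.
- case=> a x [b y]; have [z [zP z_uniq]] := qLl ((a^-1 * b : AUM L) x) y.
  exists (Hol (a^-1 * b) z); split.
    by rewrite /mul /= /hol_mul /= mulVKg zP.
  case=> c t [cP tP]; have c_def : c = a^-1 * b by rewrite -cP mulKg.
  by rewrite {}c_def in tP *; rewrite (z_uniq t).
- case=> a x [b y]; have [z [zP z_uniq]] := qLr x y.
  exists (Hol (b * a^-1) ((a^-1 : AUM L) z)); split.
    rewrite /mul /= /hol_mul /= mulgVK; congr Hol.
    by rewrite (aum_inv_funK a).
  case=> c t [cP tP]; have c_def : c = b * a^-1 by rewrite -cP mulgK.
  by rewrite c_def (z_uniq _ tP); congr Hol; exact: aum_funK.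
Qed.

Lemma hol_mulE (L : magmaType) (a b : AUM L) (x y : L) :
  Hol a x * Hol b y = Hol (a * b) (b x * y).
Proof. by []. Qed.

Lemma aum_VK (L : magmaType) (a : AUM L) : cancel (a^-1 : AUM L) a.
Proof. exact: aum_inv_funK. Qed.

Lemma aum_KV (L : magmaType) (a : AUM L) : cancel a (a^-1 : AUM L).
Proof. exact: aum_funK. Qed.

Lemma aum_right_id (L : magmaType) (e : L) (a : AUM L) :
  quasigroup L -> right_id e *%g -> a e = e.
Proof.
move=> qL e1; apply: (quasigroup_mulLI qL (a := a e)).
by rewrite -aum_morph !e1.
Qed.

Lemma aum_left_id (L : magmaType) (e : L) (a : AUM L) :
  quasigroup L -> left_id e *%g -> a e = e.
Proof.
move=> qL e1; apply: (quasigroup_mulRI qL (a := a e)).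
by rewrite -aum_morph !e1.
Qed.

(** The same formula gives right inverses in the holomorph when [J] gives right
    inverses in [L], and left inverses when [J] gives left inverses. *)
Definition hol_inv (L : magmaType) (J : L -> L) (u : holomorph L) :
    holomorph L :=
  Hol (hol_aut u)^-1 (((hol_aut u)^-1 : AUM L) (J (hol_elt u))).

Lemma hol_invE (L : magmaType) (J : L -> L) (a : AUM L) (x : L) :
  hol_inv J (Hol a x) = Hol a^-1 ((a^-1 : AUM L) (J x)).
Proof. by []. Qed.

Lemma hol_right_id (L : magmaType) (e : L) :
  right_id e *%g -> right_id (Hol 1 e : holomorph L) *%g.
Proof. by move=> e1 [a x]; rewrite hol_mulE mulg1 e1. Qed.

Lemma hol_left_id (L : magmaType) (e : L) : quasigroup L ->
  left_id e *%g -> left_id (Hol 1 e : holomorph L) *%g.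
Proof. by move=> qL e1 [a x]; rewrite hol_mulE mul1g aum_left_id // e1. Qed.

Lemma hol_right_inverse (L : magmaType) (e : L) (J : L -> L) : quasigroup L ->
    right_id e *%g -> right_inverse e J *%g ->
  right_inverse (Hol 1 e : holomorph L) (hol_inv J) *%g.
Proof.
move=> qL e1 eV [a x]; rewrite hol_invE hol_mulE mulgV.
by rewrite -aum_morph eV aum_right_id.
Qed.

Lemma hol_left_inverse (L : magmaType) (e : L) (J : L -> L) : quasigroup L ->
    left_id e *%g -> left_inverse e J *%g ->
  left_inverse (Hol 1 e : holomorph L) (hol_inv J) *%g.
Proof. by move=> qL e1 eV [a x]; rewrite hol_invE hol_mulE mulVg aum_VK eV. Qed.

Lemma is_loop_holomorph (L : magmaType) : is_loop L -> is_loop (holomorph L).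
Proof.
case=> qL [e [e1l e1r]]; split; first exact: quasigroup_holomorph.
by exists (Hol 1 e); split; [exact: hol_left_id | exact: hol_right_id].
Qed.

(** * The cross inverse identities of the holomorph *)

(** The common pattern of the four cases: the automorphism component [A a b] of
    a cross inverse identity returns [b] for all [a, b] exactly when
    automorphisms commute.  An element [x0] of [L] is needed to form pairs from
    given automorphisms. *)
Lemma hol_identityP (L : magmaType) (A : AUM L -> AUM L -> AUM L)
    (X : AUM L -> AUM L -> L -> L -> L) (C : Prop) : inhabited L ->
    ((forall a b, A a b = b) <-> commutative (@mul (AUM L))) ->
    ((forall a b x y, X a b x y = y) <-> C) ->
  (forall u v : holomorph L,
     Hol (A (hol_aut u) (hol_aut v))
         (X (hol_aut u) (hol_aut v) (hol_elt u) (hol_elt v)) = v) <->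
  commutative (@mul (AUM L)) /\ C.
Proof.
case=> x0 AP XP; split=> [uvP | [/AP Ab /XP Xy] [a x] [b y] /=]; last first.
  by rewrite Ab Xy.
split; first by apply/AP => a b; have [] := uvP (Hol a x0) (Hol b x0).
by apply/XP => a b x y; have [] := uvP (Hol a x) (Hol b y).
Qed.

Lemma conj_idP (G : groupType) :
  (forall a b : G, a * b * a^-1 = b) <-> commutative (@mul G).
Proof.
split=> [abP a b | ab_comm a b]; last by rewrite ab_comm mulKg.
by rewrite -{2}(abP a b) mulgVK.
Qed.

Lemma conjV_idP (G : groupType) :
  (forall a b : G, a^-1 * b * a = b) <-> commutative (@mul G).
Proof.
split=> [abP a b | ab_comm a b]; last by rewrite -mulgA (ab_comm b) mulKg.
by rewrite -{1}(abP a b) !mulgA mulgV mul1g.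
Qed.

Lemma hol_cross1P (L : magmaType) (J : L -> L) : inhabited L ->
  (forall u v : holomorph L, (u * v) * hol_inv J u = v) <->
  commutative (@mul (AUM L)) /\ hol_cond1 J.
Proof.
move=> inhL.
apply: (@hol_identityP L (fun a b => a * b * a^-1)
  (fun a b x y => (a^-1 : AUM L) (b x * y) * (a^-1 : AUM L) (J x))) => //.
  exact: conj_idP.
split=> [JP x y a b | JP a b x y].
  by rewrite -[RHS](congr1 a (JP a b x y)) -aum_morph aum_VK.
by rewrite -aum_morph (JP x y a b) aum_KV.
Qed.

Lemma hol_cross2P (L : magmaType) (J : L -> L) : inhabited L ->
  (forall u v : holomorph L, u * (v * hol_inv J u) = v) <->
  commutative (@mul (AUM L)) /\ hol_cond2 J.
Proof.
move=> inhL.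
apply: (@hol_identityP L (fun a b => a * (b * a^-1))
  (fun a b x y => (a^-1 : AUM L) (b x) *
                  ((a^-1 : AUM L) y * (a^-1 : AUM L) (J x)))) => //.
  apply: iff_trans (conj_idP _).
  by split=> abP a b; have := abP a b; rewrite mulgA.
split=> [JP x y a b | JP a b x y].
  by rewrite -[RHS](congr1 a (JP a b x y)) -!aum_morph aum_VK.
by rewrite -!aum_morph (JP x y a b) aum_KV.
Qed.

Lemma hol_cross3P (L : magmaType) (J : L -> L) : inhabited L ->
  (forall u v : holomorph L, (hol_inv J u * v) * u = v) <->
  commutative (@mul (AUM L)) /\ hol_cond3 J.
Proof.
move=> inhL.
apply: (@hol_identityP L (fun a b => a^-1 * b * a)
  (fun a b x y => a (b ((a^-1 : AUM L) (J x)) * y) * x)) => //.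
  exact: conjV_idP.
split=> [JP x y a b | JP a b x y]; last by rewrite aum_morph JP.
by rewrite -[RHS](JP a b x y) aum_morph.
Qed.

Lemma hol_cross4P (L : magmaType) (J : L -> L) : inhabited L ->
  (forall u v : holomorph L, hol_inv J u * (v * u) = v) <->
  commutative (@mul (AUM L)) /\ hol_cond4 J.
Proof.
move=> inhL.
apply: (@hol_identityP L (fun a b => a^-1 * (b * a))
  (fun a b x y => a (b ((a^-1 : AUM L) (J x))) * (a y * x))) => //.
  apply: iff_trans (conjV_idP _).
  by split=> abP a b; have := abP a b; rewrite mulgA.
by split=> JP; [move=> x y a b | move=> a b x y]; apply: JP.
Qed.

Lemma CIPQ_holomorph_rightP (L : magmaType) (e : L) (J : L -> L) :
    quasigroup L -> right_id e *%g -> right_inverse e J *%g ->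
  (CIPQ (holomorph L) <-> commutative (@mul (AUM L)) /\ hol_cond1 J) /\
  (CIPQ (holomorph L) <-> commutative (@mul (AUM L)) /\ hol_cond2 J).
Proof.
move=> qL e1 eV; have qH := quasigroup_holomorph qL; have [inhL _ _] := qL.
have ciP : CIPQ (holomorph L) <->
    forall u v : holomorph L, (u * v) * hol_inv J u = v.
  have HP := cross_inverse_rightP qH (hol_right_id e1)
               (hol_right_inverse qL e1 eV).
  by split=> [[_ /HP] | /HP].
split; apply: iff_trans ciP _; first exact: hol_cross1P.
exact: iff_trans (cross_mulr_swap _ qH) (hol_cross2P J inhL).
Qed.

Lemma CIPQ_holomorph_leftP (L : magmaType) (e : L) (J : L -> L) :
    quasigroup L -> left_id e *%g -> left_inverse e J *%g ->
  (CIPQ (holomorph L) <-> commutative (@mul (AUM L)) /\ hol_cond3 J) /\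
  (CIPQ (holomorph L) <-> commutative (@mul (AUM L)) /\ hol_cond4 J).
Proof.
move=> qL e1 eV; have qH := quasigroup_holomorph qL; have [inhL _ _] := qL.
have ciP : CIPQ (holomorph L) <->
    forall u v : holomorph L, hol_inv J u * (v * u) = v.
  have HP := cross_inverse_leftP qH (hol_left_id qL e1)
               (hol_left_inverse qL e1 eV).
  by split=> [[_ /HP] | /HP].
split; apply: iff_trans ciP _; last exact: hol_cross4P.
exact: iff_trans (cross_mull_swap _ qH) (hol_cross3P J inhL).
Qed.

Lemma CIPL_holomorphP (L : magmaType) :
  is_loop L -> CIPL (holomorph L) <-> CIPQ (holomorph L).
Proof.
move=> /is_loop_holomorph lH; have [qH _] := lH.
by split=> [] [_ ?]; split.
Qed.

Theorem theorem2p3 (L : magmaType) :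
  (quasigroup L ->
     (forall (e : L) (Jrho : L -> L),
        right_id e *%g -> right_inverse e Jrho *%g ->
        (CIPQ (holomorph L) <->
           commutative (@mul (AUM L)) /\ hol_cond1 Jrho) /\
        (CIPQ (holomorph L) <->
           commutative (@mul (AUM L)) /\ hol_cond2 Jrho)) /\
     (forall (e : L) (Jlambda : L -> L),
        left_id e *%g -> left_inverse e Jlambda *%g ->
        (CIPQ (holomorph L) <->
           commutative (@mul (AUM L)) /\ hol_cond3 Jlambda) /\
        (CIPQ (holomorph L) <->
           commutative (@mul (AUM L)) /\ hol_cond4 Jlambda))) /\
  (is_loop L ->
     forall (e : L) (Jrho Jlambda : L -> L),
       left_id e *%g -> right_id e *%g ->
       right_inverse e Jrho *%g -> left_inverse e Jlambda *%g ->
       [/\ CIPL (holomorph L) <->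
             commutative (@mul (AUM L)) /\ hol_cond1 Jrho,
           CIPL (holomorph L) <->
             commutative (@mul (AUM L)) /\ hol_cond2 Jrho,
           CIPL (holomorph L) <->
             commutative (@mul (AUM L)) /\ hol_cond3 Jlambda
         & CIPL (holomorph L) <->
             commutative (@mul (AUM L)) /\ hol_cond4 Jlambda]).
Proof.
split=> [qL | lL e Jrho Jlambda e1l e1r eVr eVl].
  split=> e J; first exact: CIPQ_holomorph_rightP.
  exact: CIPQ_holomorph_leftP.
have [qL _] := lL; have CIPLQ := CIPL_holomorphP lL.
have [P1 P2] := CIPQ_holomorph_rightP qL e1r eVr.
have [P3 P4] := CIPQ_holomorph_leftP qL e1l eVl.
by split; apply: iff_trans CIPLQ _.
Qed.
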